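(* Let $\tilde p$ be an integer and $\tilde q$ a positive integer with $\tilde q \geqslant 97\,|\tilde p|$. Consider the polynomial in $t$ $$P(t)=Q_{p\,q}(t)\quad\text{with } p=\tilde p+\tilde q,\ q=\tilde q,$$ where $$Q_{p q}(t)=t^{10}+(2q^2+p^2)(3q^2-2p^2)t^8+(q^8+10p^2q^6+4p^4q^4-14p^6q^2+p^8)t^6-p^2q^2(q^8-14p^2q^6+4p^4q^4+10p^6q^2+p^8)t^4-p^6q^6(q^2+2p^2)(3p^2-2q^2)t^2-q^{10}p^{10}.$$ Let $u_2,u_3,u_4,u_5$ be the four roots of the quartic $u^4+8u^2-12\,i\,u-4=0$, where $i=\sqrt{-1}$. If $\tilde p\neq 0$, then for each $k\in\{2,3,4,5\}$ the open disk $$D_k=\Bigl\{t\in\mathbb C:\ \Bigl|\,t-i\,\tilde q^{2}-u_k\,\tilde p\,\tilde q+\frac{u_k+i\,u_k^2}{2}\,\tilde p^{2}\Bigr|<\frac{51|\tilde p|^3}{\tilde q}\Bigr\}$$ contains exactly one root of $P$ (counted with multiplicity). If $\tilde p=0$, then $t=i\,\tilde q^{2}$ is a multiple root of $P$. *)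

(* Defs.v *)
From mathcomp Require Import all_boot all_order all_algebra.
From mathcomp Require Import reals.
From mathcomp Require Export complex.

Set Implicit Arguments.
Unset Strict Implicit.
Unset Printing Implicit Defensive.

Import Order.TTheory GRing.Theory Num.Theory.
Local Open Scope ring_scope.

Definition Qpoly (F : comNzRingType) (p q : F) : {poly F} :=
  'X^10
  + ((2 * q ^+ 2 + p ^+ 2) * (3 * q ^+ 2 - 2 * p ^+ 2)) *: 'X^8
  + (q ^+ 8 + 10 * p ^+ 2 * q ^+ 6 + 4 * p ^+ 4 * q ^+ 4
     - 14 * p ^+ 6 * q ^+ 2 + p ^+ 8) *: 'X^6
  - (p ^+ 2 * q ^+ 2 *
     (q ^+ 8 - 14 * p ^+ 2 * q ^+ 6 + 4 * p ^+ 4 * q ^+ 4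
      + 10 * p ^+ 6 * q ^+ 2 + p ^+ 8)) *: 'X^4
  - (p ^+ 6 * q ^+ 6 * (q ^+ 2 + 2 * p ^+ 2)
     * (3 * p ^+ 2 - 2 * q ^+ 2)) *: 'X^2
  - (q ^+ 10 * p ^+ 10)%:P.

Definition quartic (R : realType) : {poly R[i]} :=
  'X^4 + 8 *: 'X^2 - (12 * 'i%C) *: 'X - 4%:P.

(* Each root is listed as many times as its multiplicity; meaningful only for
   p != 0. *)
Definition roots_seq (F : closedFieldType) (p : {poly F}) : seq F :=
  sval (closed_field_poly_normal p).

Lemma roots_seqE (F : closedFieldType) (p : {poly F}) :
  p = lead_coef p *: \prod_(z <- roots_seq p) ('X - z%:P).
Proof. exact: svalP (closed_field_poly_normal p). Qed.

Definition nroots_in (F : closedFieldType) (p : {poly F}) (D : pred F) : nat :=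
  count D (roots_seq p).

(* The norm and the order are those of R[i], on which x < y holds iff x and y
   have the same imaginary part and Re x < Re y; both sides here are real. *)
Definition disk (R : realType) (p q : int) (u : R[i]) : pred R[i] :=
  fun t =>
    `| t - 'i%C * q%:~R ^+ 2 - u * p%:~R * q%:~R
       + (u + 'i%C * u ^+ 2) / 2 * p%:~R ^+ 2 |
    < 51 * `|p%:~R| ^+ 3 / q%:~R.

(* Main.v *)
Require Import Defs.
From Stdlib Require Import ZArith.
From mathcomp Require Import all_boot all_order all_algebra.
From mathcomp Require Import reals.
From mathcomp Require Import ssrZ zify ring lra.
Import Order.TTheory GRing.Theory Num.Theory.
Import ComplexField.Normc.

Set Implicit Arguments.
Unset Strict Implicit.
Unset Printing Implicit Defensive.

Local Open Scope ring_scope.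
Local Open Scope complex_scope.
Local Delimit Scope Z_scope with coqZ.

(** Put [p = 2 g q], [t = i q^2 (1 + 2 g x)] and [u = i v]. Then
    [P(t) = 16 g^4 q^20 H(g, x)] with [H] an integer polynomial such that
    [H(0, x) = -32 f(x)], where [f(v) = v^4 - 8 v^2 + 12 v - 4] is the quartic
    written in [v]. The disk becomes [|x - x0| < 204 |g|^2] with
    [x0 = v + g (v^2 - v)], and [x0] is the first-order approximation of the
    root of [H(g, .)] issued from [v]: modulo [f(v) = 0], [H(g, x0) = g^2 K]
    and [H'(g, x0) = D] for explicit [K] and [D] of degree 3 in [v].

    A disk of radius [rho] around [x0] contains at most one root as soon as
    [H'(g, x0)] dominates [rho] times a majorant of [H''], because the divided
    difference of [H] at two roots vanishes. Given that, if the smaller disk of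
    radius [r] contained no root, then [H'/H (x0)], which is the sum of the
    [1 / (x0 - w)] over the ten roots [w], would be at most [1/r + 9/rho].
    Numerical bounds on [K] and [D] near the four roots of [f] exclude this. *)

(** * The real-valued modulus on [R[i]] *)

Section NormC.
Variable R : rcfType.
Implicit Types x y : R[i].

Lemma normr_normc x : `|x| = (normc x)%:C.
Proof. by []. Qed.

Lemma normc_ge0 x : 0 <= normc x.
Proof. by case: x => a b; rewrite sqrtr_ge0. Qed.

Lemma normc_eq0 x : (normc x == 0) = (x == 0).
Proof. by apply/eqP/eqP => [/eq0_normc //|->]; rewrite normc0. Qed.

Lemma normc_gt0 x : (0 < normc x) = (x != 0).
Proof. by rewrite lt_def normc_ge0 normc_eq0 andbT. Qed.

Lemma normcB_sub x y : normc x - normc y <= normc (x + y).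
Proof.
by rewrite lerBlDr -{1}(addrK y x) (le_trans (le_normcD _ _)) ?normcN.
Qed.

Lemma normc_distC x y : normc (x - y) = normc (y - x).
Proof. by rewrite -normcN opprB. Qed.

Lemma normcX x n : normc (x ^+ n) = normc x ^+ n.
Proof. by elim: n => [|n IH]; rewrite ?normc1 // !exprS normcM IH. Qed.

Lemma normc_real (a : R) : normc a%:C = `|a|.
Proof. by rewrite /= expr0n addr0 sqrtr_sqr. Qed.

Lemma normc_i : normc 'i = 1 :> R.
Proof. by rewrite /normc expr0n add0r expr1n sqrtr1. Qed.

Lemma normc_int (z : int) : normc (z%:~R : R[i]) = `|z|%:~R.
Proof. by rewrite -(rmorph_int (real_complex R)) normc_real -intr_norm. Qed.

Lemma normc_nat n : normc (n%:R : R[i]) = n%:R.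
Proof. by rewrite -(rmorph_nat (real_complex R)) normc_real normr_nat. Qed.

(** The hypothesis leaves only [j = 'i] and [j = - 'i]. Keeping both signs lets one computation
    serve a pair of conjugate points. *)
Lemma normc_sqrtN1 (j : R[i]) (a b : R) : j ^+ 2 = -1 ->
  normc (a%:C + b%:C * j) ^+ 2 = a ^+ 2 + b ^+ 2.
Proof.
move=> hj; have : (j - 'i) * (j + 'i) == 0.
  by rewrite -subr_sqr sqr_i hj subrr.
rewrite mulf_eq0 subr_eq0 addr_eq0 => /orP[]/eqP ->;
  simpc; rewrite /= sqr_sqrtr ?sqrrN // addr_ge0 ?sqr_ge0 //.
Qed.

End NormC.

Local Arguments normc : simpl never.

(** * Divided differences on coefficient lists *)

Section DividedDifference.
Variable C : comNzRingType.
Implicit Types (s : seq C) (a b x : C).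

(** The divided difference [(P(b) - P(a)) / (b - a)], written without division so that it makes
    sense on the diagonal, where it is [P'(a)]. *)
Fixpoint ddiff s a b : C :=
  if s is _ :: s' then horner_rec s' a + b * ddiff s' a b else 0.

(** The second derivative, by the rule [(c + X S)'' = 2 S' + X S'']. *)
Fixpoint deriv2 s x : C :=
  if s is _ :: s' then 2 * ddiff s' x x + x * deriv2 s' x else 0.

Lemma ddiff_deriv s x : (Poly s)^`().[x] = ddiff s x x.
Proof.
elim: s => [|c s IH] /=; first by rewrite derivC horner0.
rewrite cons_poly_def derivD derivM derivX derivC !hornerE IH.
by rewrite horner_Poly addrC mulrC.
Qed.

Lemma ddiff_quotient s a b :
  exists2 D : {poly C},
    Poly s = ('X - a%:P) * D + (horner_rec s a)%:P & D.[b] = ddiff s a b.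
Proof.
elim: s => [|c s [D eqD Db]] /=.
  by exists 0; rewrite ?mulr0 ?addr0 ?horner0.
exists ('X * D + (horner_rec s a)%:P); last by rewrite !hornerE Db addrC.
by rewrite cons_poly_def {1}eqD; ring.
Qed.

End DividedDifference.

(** The quotient by [X - a] still has the factor [X - b]. A double root [a = b] is covered. *)
Lemma ddiff_root2 (C : idomainType) (s : seq C) (a b : C) (Q : {poly C}) :
  Poly s = ('X - a%:P) * (('X - b%:P) * Q) -> ddiff s a b = 0.
Proof.
move=> eqQ; have [D eqD <-] := ddiff_quotient s a b.
have sa0 : horner_rec s a = 0.
  by rewrite -horner_Poly eqQ hornerM hornerXsubC subrr mul0r.
move: eqD; rewrite sa0 addr0 eqQ.
have /mulfI inj : 'X - a%:P != 0 :> {poly C} by rewrite polyXsubC_eq0.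
by move=> /inj <-; rewrite hornerM hornerXsubC subrr mul0r.
Qed.

(** * Majorants with nonnegative coefficients and the Lipschitz bounds they give *)

Section Majorants.
Variable R : rcfType.
Implicit Types (s : seq R[i]) (m : seq R) (a b x : R[i]) (M rho : R).

Definition dominated s m := all2 (fun z c => normc z <= c) s m.

Lemma horner_dom s m a M : dominated s m -> normc a <= M ->
  normc (horner_rec s a) <= horner_rec m M.
Proof.
move=> + aM; elim: s m => [|c s IH] [|d m] //=; first by rewrite normc0.
case/andP=> cd /IH le_s; apply: le_trans (le_normcD _ _) _.
by rewrite lerD // normcM ler_pM ?normc_ge0.
Qed.

Lemma ddiff_dom s m a b M :
  dominated s m -> normc a <= M -> normc b <= M ->
  normc (ddiff s a b) <= ddiff m M M.
Proof.
move=> + aM bM; elim: s m => [|c s IH] [|d m] //=; first by rewrite normc0.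
case/andP=> _ sm; apply: le_trans (le_normcD _ _) _.
rewrite lerD ?(horner_dom sm aM) // normcM ler_pM ?normc_ge0 //; exact: IH.
Qed.

Lemma horner_lip s m a x M rho :
  dominated s m -> normc a <= M -> normc x <= M -> normc (a - x) <= rho ->
  normc (horner_rec s a - horner_rec s x) <= rho * ddiff m M M.
Proof.
move=> + aM xM axr; elim: s m => [|c s IH] [|d m] //=.
  by rewrite subrr normc0 mulr0.
case/andP=> _ sm.
have -> : horner_rec s a * a + c - (horner_rec s x * x + c) =
  (a - x) * horner_rec s a + x * (horner_rec s a - horner_rec s x) by ring.
apply: le_trans (le_normcD _ _) _; rewrite !normcM mulrDr lerD //.
  by rewrite ler_pM ?normc_ge0 // (horner_dom sm).
by rewrite mulrCA ler_pM ?normc_ge0 // IH.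
Qed.

(** Each of the two arguments moves by at most [rho] and contributes half of the second derivative
    of the majorant. *)
Lemma ddiff_lip s m a b x M rho :
  dominated s m -> normc a <= M -> normc b <= M -> normc x <= M ->
  normc (a - x) <= rho -> normc (b - x) <= rho ->
  normc (ddiff s a b - ddiff s x x) <= rho * deriv2 m M.
Proof.
move=> + aM bM xM axr bxr; elim: s m => [|c s IH] [|d m] //=.
  by rewrite subrr normc0 mulr0.
case/andP=> _ sm.
have -> : horner_rec s a + b * ddiff s a b - (horner_rec s x + x * ddiff s x x)
  = (horner_rec s a - horner_rec s x) + (b - x) * ddiff s x x
    + b * (ddiff s a b - ddiff s x x) by ring.
apply: le_trans (le_normcD _ _) _; rewrite [in leRHS]mulrDr lerD //.
  apply: le_trans (le_normcD _ _) _.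
  rewrite mulrA -(mulrC 2) -mulrA mulr_natl mulr2n.
  rewrite lerD ?(horner_lip sm aM) // normcM.
  by rewrite ler_pM ?normc_ge0 // (ddiff_dom sm).
by rewrite normcM mulrCA ler_pM ?normc_ge0 // IH.
Qed.

End Majorants.

(** * Counting roots in a disk around an approximate root *)

Section RootCounting.
Variable R : rcfType.
Implicit Types (s ws : seq R[i]) (m : seq R).

Definition cball (x0 : R[i]) (r : R) : pred R[i] :=
  fun w => normc (w - x0) < r.

Lemma deriv_prod_XsubC (C : fieldType) (ws : seq C) (x : C) : x \notin ws ->
  (\prod_(w <- ws) ('X - w%:P))^`().[x] =
  (\prod_(w <- ws) ('X - w%:P)).[x] * \sum_(w <- ws) (x - w)^-1.
Proof.
elim: ws => [|w ws IH]; first by rewrite !big_nil derivC !hornerE ?mulr0.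
rewrite inE negb_or !big_cons => /andP[xw /IH eq_ws].
rewrite derivM derivXsubC !hornerE eq_ws mulrDr.
by rewrite mulrAC divff ?subr_eq0 // mul1r mulrA.
Qed.

Lemma count_le1 s m ws (k x0 : R[i]) (rho M : R) :
  Poly s = k *: \prod_(w <- ws) ('X - w%:P) -> dominated s m ->
  0 <= rho -> normc x0 + rho <= M ->
  rho * deriv2 m M < normc (ddiff s x0 x0) ->
  (count (cball x0 rho) ws <= 1)%N.
Proof.
move=> eqs dom rho0 leM lt_d; rewrite leqNgt; apply/negP => gt1.
pose D := cball x0 rho; have /permPl := perm_filterC D ws.
(* The first two entries [a], [b] of the filtered list may be equal, so multiplicities are
   counted. *)
rewrite -size_filter -/D in gt1.
case: (filter D ws) (filter_all D ws) gt1 => [|a [|b l]] //= /and3P[Da Db _] _.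
rewrite perm_sym => eq_ws; move: eqs; rewrite (perm_big _ eq_ws) /= !big_cons.
rewrite !scalerAr => /ddiff_root2 d0.
have leD w : D w -> normc w <= M.
  move=> /ltW Dw; apply: le_trans leM; rewrite -{1}(subrK x0 w) addrC.
  by rewrite (le_trans (le_normcD _ _)) // lerD2l.
have x0M : normc x0 <= M by apply: le_trans leM; rewrite lerDl.
have := ddiff_lip dom (leD _ Da) (leD _ Db) x0M (ltW Da) (ltW Db).
by rewrite d0 sub0r normcN leNgt lt_d.
Qed.

(** A root inside the ball of radius [rho] contributes at most [1 / r], any other at most
    [1 / rho]. *)
Lemma sum_inv_le ws (x0 : R[i]) (r rho : R) : 0 < r -> r <= rho ->
  all (fun w => r <= normc (x0 - w)) ws ->
  normc (\sum_(w <- ws) (x0 - w)^-1) <=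
    (count (cball x0 rho) ws)%:R * (r^-1 - rho^-1)
    + (size ws)%:R * rho^-1.
Proof.
move=> r0 ler; have rho0 := lt_le_trans r0 ler.
elim: ws => [|w ws IH] /=; first by rewrite big_nil normc0 !mul0r addr0.
case/andP=> rw /IH {}IH; rewrite big_cons (le_trans (le_normcD _ _)) //.
rewrite normcV natrD mulrDl -addn1 natrD [in leRHS]mulrDl mul1r.
have -> (A B X Y : R) : A + B + (X + Y) = (A + Y) + (B + X) by ring.
rewrite lerD // normc_distC; rewrite normc_distC in rw.
have w0 := lt_le_trans r0 rw.
rewrite /cball; case: ltP => [_|lew] /=.
  by rewrite mulr1n mul1r subrK lef_pV2 ?posrE.
by rewrite mulr0n mul0r add0r lef_pV2 ?posrE.
Qed.

(* Existence: if no root is closer than [r], the logarithmic derivative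
   [\sum 1 / (x0 - w)] has modulus at most [1 / r + n / rho]. *)
Lemma count_eq1 n s m ws (k x0 : R[i]) (r rho M : R) :
  Poly s = k *: \prod_(w <- ws) ('X - w%:P) -> dominated s m ->
  (size ws <= n.+1)%N -> 0 < r -> r <= rho -> normc x0 + rho <= M ->
  rho * deriv2 m M < normc (ddiff s x0 x0) ->
  normc (horner_rec s x0) * (r^-1 + n%:R / rho) < normc (ddiff s x0 x0) ->
  count (cball x0 r) ws = 1%N.
Proof.
move=> eqs dom sz r0 ler leM lt_d lt_h; have rho0 := lt_le_trans r0 ler.
have le1 := count_le1 eqs dom (ltW rho0) leM lt_d.
apply/eqP; rewrite eqn_leq; apply/andP; split.
  apply: leq_trans le1; apply: sub_count => w lt_w; exact: lt_le_trans lt_w ler.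
rewrite -has_count; apply/negPn/negP; rewrite -all_predC => far.
have {}far : all (fun w => r <= normc (x0 - w)) ws.
  by apply: sub_all far => w /=; rewrite -leNgt normc_distC.
have x0_ws : x0 \notin ws.
  apply/negP => /(allP far); rewrite subrr normc0; lra.
move: lt_h; apply/negP; rewrite -leNgt.
have -> : ddiff s x0 x0 =
    horner_rec s x0 * \sum_(w <- ws) (x0 - w)^-1.
  rewrite -ddiff_deriv -horner_Poly eqs derivZ !hornerZ.
  by rewrite deriv_prod_XsubC ?mulrA.
rewrite normcM ler_wpM2l ?normc_ge0 //.
apply: le_trans (sum_inv_le r0 ler far) _.
have ir : rho^-1 <= r^-1 by rewrite lef_pV2 ?posrE.
have irho : 0 <= rho^-1 by rewrite invr_ge0 ltW.
(* By [le1], at most one of the [n.+1] terms needs the weaker bound [1 / r]. *)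
apply: le_trans (_ : (r^-1 - rho^-1) + n.+1%:R / rho <= _); last first.
  by rewrite -natr1 mulrDl mul1r; lra.
rewrite lerD //; last by rewrite ler_wpM2r ?ler_nat.
by rewrite -[leRHS]mul1r ler_wpM2r ?subr_ge0 // -[1]/(1%:R) ler_nat.
Qed.

End RootCounting.

(** * Integer polynomials in two variables as coefficient tables *)

Section Tables.
Variable C : nzRingType.

Definition row_at (g : C) (l : seq Z) : C :=
  horner_rec [seq (int_of_Z z)%:~R | z <- l] g.

Definition table_at (T : seq (seq Z)) (g : C) : seq C :=
  [seq row_at g l | l <- T].

Definition table_eval (T : seq (seq Z)) (g x : C) : C :=
  horner_rec (table_at T g) x.

End Tables.

Definition table_abs (T : seq (seq Z)) : seq (seq Z) :=
  [seq [seq Z.abs z | z <- l] | l <- T].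

(** The part of order at least two in [g], divided by [g ^+ 2]. *)
Definition drop2 (T : seq (seq Z)) : seq (seq Z) := [seq drop 2 l | l <- T].

Ltac unfold_tables :=
  rewrite /table_eval /table_at /table_abs /drop2 /row_at;
  cbn [map horner_rec ddiff deriv2 drop Z.abs].

(* Row [i] of a table lists the coefficients of [x ^+ i] (respectively [v ^+ i])
   as polynomials in [g]: [htab], [ktab], [dtab] are the [H], [K], [D] of the
   header. *)
Definition htab : seq (seq Z) :=
  [:: [:: 128; 768; 2048; 3072; 2688; 1280; 256];
      [:: -384; -1408; -1152; 3200; 9216; 9984; 5120; 1024];
      [:: 256; -1408; -10368; -25216; -31104; -19456; -4864];
      [:: 0; 2048; 3584; -9728; -44544; -72192; -61440; -30720; -10240; -2048];
      [:: -32; -320; 4032; 14848; 15104; -13312; -45056; -40960; -17920; -5120;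
          -1024];
      [:: 0; -192; -1280; 1280; 12800; 22528; 10752; -10752; -12288; -3072];
      [:: 0; 0; -512; -1920; -3456; -512; 5120; 3584; -3584; -4096; -1024];
      [:: 0; 0; 0; -768; -1280; -3328; -4096; -2048];
      [:: 0; 0; 0; 0; -672; -320; -832; -1024; -512];
      [:: 0; 0; 0; 0; 0; -320];
      [:: 0; 0; 0; 0; 0; 0; -64]]%coqZ.

Definition ktab : seq (seq Z) :=
  [:: [:: -5120; 167424; -2736640; 29434368; -237198848; 1488850944;
          -7528832000; 31015002112; -104596097024; 287231741952; -633121251840;
          1089874246656; -1391500993536; 1201271906304; -553579102208];
      [:: 16896; -551168; 8998144; -96916224; 780360960; -4899948544;
          24774993920; -102063853568; 344202006528; -945214017536;
          2083458776064; -3586528476160; 4579113937920; -3953113120768;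
          1821703151616];
      [:: -15104; 497280; -8064640; 87194496; -700802944; 4403574784;
          -22260077824; 91708411392; -309277101568; 849304946688;
          -1872057211392; 3222613466112; -4114484747264; 3552002271232;
          -1636860257280];
      [:: 4352; -145408; 2338048; -25386496; 203682304; -1280589824;
          6472543744; -26666153472; 89929900544; -246954377216; 544344019968;
          -937048775680; 1196381015040; -1032826279936; 475954733056]]%coqZ.

Definition dtab : seq (seq Z) :=
  [:: [:: -384; -6784; -23680; -496512; 3810304; -43680768; 321183744;
          -1926576128; 9197225984; -35492349952; 110316447744; -272810936320;
          523589943296; -741312726016; 706315517952; -360161157120];
      [:: 512; 12800; 20480; 1414656; -13128192; 142569472; -1058732544;
          6337791488; -30267930624; 116796118016; -363026429952; 897759524864;
          -1723014995968; 2439492171776; -2324323960832; 1185208608768];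
      [:: 0; -4096; 38144; -1006848; 12622592; -126294784; 954160640;
          -5691402240; 27199465472; -104943986688; 326190535680; -806668108800;
          1548184399872; -2191964566528; 2088481492992; -1064948963328];
      [:: -128; -896; -26496; 226432; -3850752; 36410112; -277758976;
          1654850560; -7908436992; 30515841024; -94846134272; 234558380032;
          -450169585664; 637364262912; -607273953280; 309658384384]]%coqZ.

Lemma htab_ktab (C : comNzRingType) (g v : C) :
  v ^+ 4 = 8 * v ^+ 2 - 12 * v + 4 ->
  table_eval htab g (v + g * (v ^+ 2 - v)) = g ^+ 2 * table_eval ktab g v.
Proof. by move=> hv; rewrite /htab /ktab; unfold_tables; ring: hv. Qed.

Lemma htab_dtab (C : comNzRingType) (g v : C) :
  v ^+ 4 = 8 * v ^+ 2 - 12 * v + 4 ->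
  let x := v + g * (v ^+ 2 - v) in
  ddiff (table_at htab g) x x = table_eval dtab g v.
Proof. by move=> hv /=; rewrite /htab /dtab; unfold_tables; ring: hv. Qed.

Definition tcol (k : nat) (T : seq (seq Z)) : seq Z :=
  [seq nth Z0 l k | l <- T].

(** Orders 0 and 1 in [g] are isolated because they need sharp values near the roots of the quartic;
    a crude majorant is enough for the rest. *)
Lemma table_split (C : comNzRingType) T (g v : C) :
  table_eval T g v =
  row_at v (tcol 0 T) + g * row_at v (tcol 1 T)
  + g ^+ 2 * table_eval (drop2 T) g v.
Proof.
rewrite /table_eval /row_at; elim: T => [|l T /= ->] /=.
  by rewrite !mulr0 !addr0.
have -> : row_at g l = (int_of_Z (nth Z0 l 0))%:~R
    + g * (int_of_Z (nth Z0 l 1))%:~R + g ^+ 2 * row_at g (drop 2 l).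
  rewrite /row_at; case: l => [|a [|b l]] /=; rewrite ?drop0; ring.
ring.
Qed.

(** * Majorants of tables *)

Section Domination.
Variable R : rcfType.
Implicit Types (g : R[i]) (gam : R).

Lemma dominated_row (l : seq Z) :
  dominated [seq (int_of_Z z)%:~R | z <- l]
            [seq (int_of_Z z)%:~R : R | z <- [seq Z.abs z | z <- l]].
Proof.
elim: l => //= z l ->; rewrite andbT normc_int.
by have -> : `|int_of_Z z| = int_of_Z (Z.abs z) by lia.
Qed.

Lemma dominated_table T g gam : normc g <= gam ->
  dominated (table_at T g) (table_at (table_abs T) gam).
Proof.
by move=> le_g; elim: T => //= l T ->; rewrite andbT horner_dom ?dominated_row.
Qed.

Lemma table_eval_dom T g gam v M : normc g <= gam -> normc v <= M ->
  normc (table_eval T g v) <= table_eval (table_abs T) gam M.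
Proof. by move=> le_g; apply: horner_dom; apply: dominated_table. Qed.

End Domination.

(** The change of variable is an identity of polynomials, not only of values, so that roots
    correspond with their multiplicities. *)
Lemma Qpoly_htab (R : rcfType) (g q : R[i]) :
  Qpoly (q + 2 * g * q) q \Po (('i * q ^+ 2 * (2 * g)) *: 'X + ('i * q ^+ 2)%:P)
  = (16 * g ^+ 4 * q ^+ 20) *: Poly (table_at htab g).
Proof.
have hi : ('i%:P : {poly R[i]}) ^+ 2 = -1 by rewrite -polyC_exp sqr_i polyCN.
rewrite /Qpoly /htab; unfold_tables.
cbn [Poly foldr]; rewrite !cons_poly_def.
rewrite !(comp_polyB, comp_polyD, comp_polyZ, comp_Xn_poly, comp_polyC).
rewrite -!mul_polyC.
by ring: hi.
Qed.

(** * Localization of the roots of the quartic *)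

Section Localization.
Variable R : rcfType.
Implicit Types (j v g : R[i]) (al be t : R).

Lemma normc_le_sqr j al be t : j ^+ 2 = -1 ->
  al ^+ 2 + be ^+ 2 <= t ^+ 2 -> 0 <= t -> normc (al%:C + be%:C * j) <= t.
Proof.
by move=> hj + t0; rewrite -(normc_sqrtN1 _ _ hj) ler_sqr ?nnegrE ?normc_ge0.
Qed.

Lemma normc_ge_sqr j al be t : j ^+ 2 = -1 ->
  t ^+ 2 <= al ^+ 2 + be ^+ 2 -> 0 <= t -> t <= normc (al%:C + be%:C * j).
Proof.
by move=> hj + t0; rewrite -(normc_sqrtN1 _ _ hj) ler_sqr ?nnegrE ?normc_ge0.
Qed.

(** Beyond [7 / 2] the term of degree four outweighs all the others. *)
Lemma quartic_root_le v :
  v ^+ 4 = 8 * v ^+ 2 - 12 * v + 4 -> normc v <= 7 / 2.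
Proof.
move=> hv; have := normc_ge0 v.
have : normc (v ^+ 4) <= 8 * normc v ^+ 2 + 12 * normc v + 4.
  rewrite hv; apply: le_trans (le_normcD _ _) _; apply: lerD.
    apply: le_trans (le_normcD _ _) _; rewrite normcN.
    rewrite [normc (8 * _)]normcM [normc (12 * _)]normcM normcX.
    by rewrite !normc_nat.
  by rewrite normc_nat.
rewrite normcX; move: (normc v : R) => {hv} x h4 x0.
rewrite leNgt; apply/negP => lt_x.
have h2 : 7 / 2 * x <= x ^+ 2 by rewrite expr2; nra.
have h3 : 49 / 4 * x ^+ 2 <= x ^+ 4.
  by rewrite (exprD x 2 2) ler_wpM2r ?sqr_ge0 //; lra.
lra.
Qed.

(** Replacing [j] by [- j] gives the conjugate point. *)
Definition center (al be : R) j : R[i] := al%:C + be%:C * j.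

Lemma center_dist j al be al' be' v t : j ^+ 2 = -1 -> 0 <= t ->
  t ^+ 2 <= (al - al') ^+ 2 + (be - be') ^+ 2 ->
  t <= normc (v - center al be j) + normc (v - center al' be' j).
Proof.
move=> hj t0 le_t; rewrite [X in X + _]normc_distC.
apply: le_trans (le_normcD _ _); rewrite /center.
have -> : al%:C + be%:C * j - v + (v - (al'%:C + be'%:C * j)) =
  (al - al')%:C + (be - be')%:C * j by rewrite !rmorphB /=; ring.
exact: normc_ge_sqr.
Qed.

(** The four centers sum to zero, so the monic quartic vanishing at them has no cubic term.
    Subtracting the equation of [v] leaves a quadratic whose coefficients measure how far the
    centers are from the exact roots. *)
Lemma center_prod j al be al3 v :
  j ^+ 2 = -1 -> v ^+ 4 = 8 * v ^+ 2 - 12 * v + 4 ->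
  (v - center al be j) * (v - center al (- be) j) *
    ((v - center al3 0 j) * (v - center (- 2 * al - al3) 0 j)) =
  let A := al ^+ 2 + be ^+ 2 in let B := (2 * al + al3) * al3 in
  horner_rec [:: (4 - A * B)%:C; (2 * al * (A + B) - 12)%:C;
    (A - B - 4 * al ^+ 2 + 8)%:C] v.
Proof. by move=> hj hv /=; rewrite /center; ring: hj hv. Qed.

(** If all four distances exceed [31 / 100], their product exceeds [(31 / 100)^4], which is above
    [91 / 10000]. Otherwise the separations keep the other three large: their product is at least 2,
    and the small distance is at most [91 / 20000 < 1 / 200]. *)
Lemma one_distance_small (a b c d : R) :
  0 <= a -> 0 <= b -> 0 <= c -> 0 <= d ->
  a * b * (c * d) <= 91 / 100 / 100 ->
  92 / 100 <= a + b -> 109 / 100 <= a + c -> 109 / 100 <= b + c ->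
  49 / 10 <= a + d -> 49 / 10 <= b + d -> 39 / 10 <= c + d ->
  [\/ a <= 1 / 200, b <= 1 / 200, c <= 1 / 200 | d <= 1 / 200].
Proof.
move=> a0 b0 c0 d0 prod_le ab ac bc ad bd cd.
have ge_prod (x y z k l m : R) : 0 <= k -> 0 <= l -> 0 <= m ->
    k <= x -> l <= y -> m <= z -> k * l * m <= x * y * z.
  by move=> *; rewrite !ler_pM ?mulr_ge0.
have small (x P : R) :
    0 <= x -> 2 <= P -> x * P <= 91 / 100 / 100 -> x <= 1 / 200.
  by move=> x0 P2; have := ler_wpM2l x0 P2; lra.
have [le_a|gt_a] := leP a (31 / 100).
  apply: Or41; apply: (small _ (b * c * d)) => //; last first.
    by rewrite !mulrA in prod_le *.
  by apply: le_trans
    (ge_prod _ _ _ (61 / 100) (78 / 100) (459 / 100) _ _ _ _ _ _); lra.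
have [le_b|gt_b] := leP b (31 / 100).
  apply: Or42; apply: (small _ (a * c * d)) => //; last first.
    by rewrite !mulrA (mulrC b) -!mulrA in prod_le *.
  by apply: le_trans
    (ge_prod _ _ _ (61 / 100) (78 / 100) (459 / 100) _ _ _ _ _ _); lra.
have [le_c|gt_c] := leP c (31 / 100).
  apply: Or43; apply: (small _ (a * b * d)) => //; last by rewrite mulrCA.
  by apply: le_trans
    (ge_prod _ _ _ (78 / 100) (78 / 100) (359 / 100) _ _ _ _ _ _); lra.
have [le_d|gt_d] := leP d (31 / 100).
  apply: Or44; apply: (small _ (a * b * c)) => //; last first.
    by rewrite mulrC -(mulrA (a * b)).
  by apply: le_trans
    (ge_prod _ _ _ (459 / 100) (459 / 100) (359 / 100) _ _ _ _ _ _); lra.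
have := ge_prod a b (c * d) (31 / 100) (31 / 100) (31 / 100 * (31 / 100)).
have : 31 / 100 * (31 / 100) <= c * d by rewrite ler_pM //; lra.
by move=> hcd /(_ _ _ _ _ _ hcd); lra.
Qed.

(* The four centers approximate the roots of the quartic, so that the product
   of the distances from [v] to them is small. *)
Lemma quartic_root_near v : v ^+ 4 = 8 * v ^+ 2 - 12 * v + 4 ->
  exists j, j ^+ 2 = -1 /\
  [\/ normc (v - center (3691 / 2500) (23 / 50) j) <= 1 / 200,
      normc (v - center (304 / 625) 0 j) <= 1 / 200
    | normc (v - center (- (4299 / 1250)) 0 j) <= 1 / 200].
Proof.
have sum0 : - (4299 / 1250) = - 2 * (3691 / 2500) - 304 / 625 :> R.
  by clear; lra.
have ab : (92 / 100) ^+ 2 <=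
  (3691 / 2500 - 3691 / 2500) ^+ 2 + (23 / 50 - - (23 / 50)) ^+ 2 :> R.
  by clear; lra.
have ac : (109 / 100) ^+ 2 <=
  (3691 / 2500 - 304 / 625) ^+ 2 + (23 / 50 - 0) ^+ 2 :> R by clear; lra.
have bc : (109 / 100) ^+ 2 <=
  (3691 / 2500 - 304 / 625) ^+ 2 + (- (23 / 50) - 0) ^+ 2 :> R by clear; lra.
have ad : (49 / 10) ^+ 2 <=
  (3691 / 2500 - - (4299 / 1250)) ^+ 2 + (23 / 50 - 0) ^+ 2 :> R by clear; lra.
have bd : (49 / 10) ^+ 2 <=
  (3691 / 2500 - - (4299 / 1250)) ^+ 2 + (- (23 / 50) - 0) ^+ 2 :> R.
  by clear; lra.
have cd : (39 / 10) ^+ 2 <=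
  (304 / 625 - - (4299 / 1250)) ^+ 2 + (0 - 0) ^+ 2 :> R by clear; lra.
move=> hv; have hi : ('i : R[i]) ^+ 2 = -1 by rewrite sqr_i.
have hi' : (- 'i : R[i]) ^+ 2 = -1 by rewrite sqrrN.
have dist := center_dist v hi (divr_ge0 (ler0n R _) (ler0n R _)).
have prod_le := center_prod (3691 / 2500) (23 / 50) (304 / 625) hi hv.
have {}prod_le : normc (v - center (3691 / 2500) (23 / 50) 'i)
  * normc (v - center (3691 / 2500) (- (23 / 50)) 'i)
  * (normc (v - center (304 / 625) 0 'i)
     * normc (v - center (- (4299 / 1250)) 0 'i)) <= 91 / 100 / 100.
  rewrite -!normcM sum0 prod_le.
  (* The list [m] bounds the coefficients of the quadratic remainder; its value at [7 / 2] is below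
     [91 / 10000]. *)
  apply: le_trans (horner_dom
    (m := [:: 33 / 1000 / 100; 73 / 1000 / 100; 1 / 2000])
    _ (quartic_root_le hv)) _.
    rewrite /dominated /= !normc_real !ler_norml.
    by clear; lra.
  by clear; rewrite /=; lra.
have [||||||le_d|le_d|le_d|le_d] := one_distance_small (normc_ge0 _)
  (normc_ge0 _) (normc_ge0 _) (normc_ge0 _) prod_le; try exact: dist.
- by exists 'i; split=> //; apply: Or31.
(* The conjugate center becomes the first one when [j] is [- 'i]. *)
- exists (- 'i); split=> //; apply: Or31.
  by move: le_d; rewrite /center rmorphN mulrN mulNr.
- by exists 'i; split=> //; apply: Or32.
- by exists 'i; split=> //; apply: Or33.
Qed.
End Localization.

(** * Evaluation of tables near a center, with error bounds *)

Section Estimates.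
Variable R : rcfType.
Implicit Types (j v g c : R[i]) (al be t gam M del : R).

(** Cost of moving orders 0 and 1 in [g] to a center at distance [del], plus the whole remainder of
    order two. *)
Definition table_err T gam M del : R :=
  del * (ddiff [seq (int_of_Z (Z.abs z))%:~R | z <- tcol 0 T] M M
         + gam * ddiff [seq (int_of_Z (Z.abs z))%:~R | z <- tcol 1 T] M M)
  + gam ^+ 2 * table_eval (table_abs (drop2 T)) gam M.

Lemma table_near T g v c gam M del : normc g <= gam -> normc v <= M ->
  normc c <= M -> normc (v - c) <= del ->
  normc (table_eval T g v - (row_at c (tcol 0 T) + g * row_at c (tcol 1 T)))
    <= table_err T gam M del.
Proof.
move=> le_g le_v le_c le_vc.
have lip l : normc (row_at v l - row_at c l) <=
    del * ddiff [seq (int_of_Z (Z.abs z))%:~R | z <- l] M M.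
  apply: horner_lip => //; have := @dominated_row R l; by rewrite -map_comp.
rewrite table_split; set V0 := row_at v _; set V1 := row_at v _.
set C0 := row_at c _; set C1 := row_at c _; set W := table_eval _ _ _.
have -> : V0 + g * V1 + g ^+ 2 * W - (C0 + g * C1) =
  (V0 - C0) + g * (V1 - C1) + g ^+ 2 * W by ring.
rewrite /table_err [in leRHS]mulrDr.
apply: le_trans (le_normcD _ _) _; apply: lerD.
  apply: le_trans (le_normcD _ _) _; rewrite lerD ?lip // normcM mulrCA.
  by rewrite ler_pM ?normc_ge0 ?lip.
rewrite normcM normcX ler_pM ?exprn_ge0 ?normc_ge0 ?table_eval_dom //.
by rewrite lerXn2r ?nnegrE ?normc_ge0 // (le_trans (normc_ge0 g)).
Qed.

(** Together with [cubic_im], the expansion of a cubic at [al + be j]; it turns complex estimates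
    into rational inequalities. *)
Definition cubic_re (l : seq Z) al be : R :=
  row_at al l - (int_of_Z (nth Z0 l 2))%:~R * be ^+ 2
  - 3 * (int_of_Z (nth Z0 l 3))%:~R * al * be ^+ 2.

Definition cubic_im (l : seq Z) al be : R :=
  be * ((int_of_Z (nth Z0 l 1))%:~R + 2 * (int_of_Z (nth Z0 l 2))%:~R * al
        + (int_of_Z (nth Z0 l 3))%:~R * (3 * al ^+ 2 - be ^+ 2)).

Lemma cubic_center l al be j : size l = 4 -> j ^+ 2 = -1 ->
  row_at (center al be j) l = center (cubic_re l al be) (cubic_im l al be) j.
Proof.
case: l => [|k0 [|k1 [|k2 [|k3 []]]]] // _ hj.
by rewrite /center /cubic_re /cubic_im /row_at /=; ring: hj.
Qed.

Definition csqr (l : seq Z) al be : R :=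
  cubic_re l al be ^+ 2 + cubic_im l al be ^+ 2.

Lemma center_normc_le j al be t v del : j ^+ 2 = -1 -> 0 <= t ->
  al ^+ 2 + be ^+ 2 <= t ^+ 2 -> normc (v - center al be j) <= del ->
  normc v <= t + del.
Proof.
move=> hj t0 le_t le_v; rewrite -(subrK (center al be j) v) addrC.
by apply: le_trans (le_normcD _ _) _; rewrite lerD // normc_le_sqr.
Qed.

End Estimates.

Ltac eval_tables :=
  rewrite /table_err /csqr /cubic_re /cubic_im /ktab /dtab;
  cbn [tcol drop2 map nth drop table_abs Z.abs]; unfold_tables.

(** * Numerical bounds for [H], [K] and [D] *)

Section Bounds.
Variable R : rcfType.
Implicit Types (j v g : R[i]) (al be : R).

(** Rounded majorants of the coefficients of [H(g, .)], uniform for [|g| <= 1 / 194]. *)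
Definition hmaj : seq R :=
  [:: 133; 392; 264; 11; 34; 11 / 10; 1 / 50; 1 / 1000;
      1 / 1000 / 1000; 1 / 1000 / 1000; 1 / 1000 / 1000].

Lemma htab_hmaj g : normc g <= 1 / 194 -> dominated (table_at htab g) hmaj.
Proof.
move=> le_g; have row_le l t : row_at (1 / 194) [seq Z.abs z | z <- l] <= t ->
    normc (row_at g l) <= t.
  by apply: le_trans; apply: horner_dom => //; apply: dominated_row.
have cons_le z s m (M : seq R) :
  normc z <= m -> dominated s M -> dominated (z :: s) (m :: M).
  by rewrite /dominated /= => -> ->.
rewrite /htab /hmaj /table_at; cbn [map].
by do !(apply: (cons_le);
        first by apply: (row_le); clear; unfold_tables; lra).
Qed.

Lemma hmaj_deriv2_small : deriv2 hmaj (41 / 25) <= 190 * 10.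
Proof. by rewrite /hmaj; cbn [deriv2 ddiff horner_rec]; lra. Qed.

Lemma hmaj_deriv2_large : deriv2 hmaj (19 / 5) <= 81 * 100.
Proof. by rewrite /hmaj; cbn [deriv2 ddiff horner_rec]; lra. Qed.

Lemma dtab_err_small :
  table_err dtab (1 / 194) (194 / 125) (1 / 200) <= 16 :> R.
Proof. by eval_tables; lra. Qed.

Lemma ktab_err_small :
  table_err ktab (1 / 194) (194 / 125) (1 / 200) <= 182 * 10 :> R.
Proof. by eval_tables; lra. Qed.

Lemma dtab_err_large :
  table_err dtab (1 / 194) (69 / 20) (1 / 200) <= 75 :> R.
Proof. by eval_tables; lra. Qed.

Lemma ktab_err_large :
  table_err ktab (1 / 194) (69 / 20) (1 / 200) <= 80 * 100 :> R.
Proof. by eval_tables; lra. Qed.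

Lemma affine_normc_ge (X A B g : R[i]) (gam t0 t1 err : R) : normc g <= gam ->
  t0 <= normc A -> normc B <= t1 -> normc (X - (A + g * B)) <= err ->
  t0 - gam * t1 - err <= normc X.
Proof.
move=> le_g le_A le_B le_X.
have le_gB : normc (g * B) <= gam * t1 by rewrite normcM ler_pM ?normc_ge0.
have := normcB_sub A (g * B); have := le_normcD X (- (X - (A + g * B))).
rewrite normcN opprB addrC subrK; lra.
Qed.

Lemma affine_normc_le (X A B g : R[i]) (gam t0 t1 err : R) : normc g <= gam ->
  normc A <= t0 -> normc B <= t1 -> normc (X - (A + g * B)) <= err ->
  normc X <= t0 + gam * t1 + err.
Proof.
move=> le_g le_A le_B le_X; rewrite -(subrK (A + g * B) X) addrC.
apply: le_trans (le_normcD _ _) _; apply: lerD => //.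
by apply: le_trans (le_normcD _ _) _; rewrite lerD // normcM ler_pM ?normc_ge0.
Qed.

(** Covers the conjugate pair and the small real root together: [1547 / 1000] bounds the moduli of
    their centers, and adding [1 / 200] gives [194 / 125]. *)
Lemma small_bounds j al be v g : j ^+ 2 = -1 -> normc g <= 1 / 194 ->
  normc (v - center al be j) <= 1 / 200 ->
  al ^+ 2 + be ^+ 2 <= (1547 / 1000) ^+ 2 ->
  149 ^+ 2 <= csqr (tcol 0 dtab) al be ->
  csqr (tcol 1 dtab) al be <= (305 * 10) ^+ 2 ->
  csqr (tcol 0 ktab) al be <= 81 ^+ 2 ->
  csqr (tcol 1 ktab) al be <= (152 * 10) ^+ 2 ->
  [/\ normc v <= 194 / 125, 117 <= normc (table_eval dtab g v)
    & normc (table_eval ktab g v) <= 20 * 100].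
Proof.
move=> hj le_g le_v le_c D0 D1 K0 K1.
have c_le : normc (center al be j) <= 194 / 125.
  apply: (@le_trans _ _ (1547 / 1000)); last by clear; lra.
  by apply: normc_le_sqr => //; rewrite divr_ge0.
have v_le : normc v <= 194 / 125.
  have -> : 194 / 125 = 1547 / 1000 + 1 / 200 :> R by clear; lra.
  by apply: center_normc_le le_v => //; rewrite divr_ge0.
have nd := table_near dtab le_g v_le c_le le_v.
have nk := table_near ktab le_g v_le c_le le_v.
rewrite !cubic_center // in nd nk.
have {}D0 := normc_ge_sqr hj D0 ltac:(by rewrite ?mulr_ge0).
have {}D1 := normc_le_sqr hj D1 ltac:(by rewrite ?mulr_ge0).
have {}K0 := normc_le_sqr hj K0 ltac:(by rewrite ?mulr_ge0).
have {}K1 := normc_le_sqr hj K1 ltac:(by rewrite ?mulr_ge0).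
rewrite -!/(center _ _ _) in D0 D1 K0 K1.
have {}nd := le_trans nd dtab_err_small.
have {}nk := le_trans nk ktab_err_small.
have leD := affine_normc_ge le_g D0 D1 nd.
have leK := affine_normc_le le_g K0 K1 nk.
by split=> //; [move: leD | move: leK]; clear; lra.
Qed.

(* [K / D] is close to [-136] at the fourth center. *)
Definition comb_re n : R := cubic_re (tcol n ktab) (- (4299 / 1250)) 0
  + 136 * cubic_re (tcol n dtab) (- (4299 / 1250)) 0.

Definition comb_im n : R := cubic_im (tcol n ktab) (- (4299 / 1250)) 0
  + 136 * cubic_im (tcol n dtab) (- (4299 / 1250)) 0.

(** Separate estimates of [K] and [D] would not reach the ratio of about 170 required in
    [root_bounds]. In [K + 136 D] the order 0 nearly cancels and the order 1 is much reduced. *)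
Lemma large_bounds j v g (c := center (- (4299 / 1250)) 0 j : R[i]) :
  j ^+ 2 = -1 -> normc g <= 1 / 194 -> normc (v - c) <= 1 / 200 ->
  [/\ normc v <= 69 / 20, 265 * 10 <= normc (table_eval dtab g v)
    & normc (table_eval ktab g v) <=
      136 * normc (table_eval dtab g v) + 490 * 100].
Proof.
have num_c : (- (4299 / 1250)) ^+ 2 + 0 ^+ 2 <= (344 / 100) ^+ 2 :> R.
  by clear; lra.
have num_D0 : (306 * 10) ^+ 2 <= csqr (tcol 0 dtab) (- (4299 / 1250)) 0 :> R.
  by clear; eval_tables; lra.
have num_D1 : csqr (tcol 1 dtab) (- (4299 / 1250)) 0 <= (629 * 100) ^+ 2 :> R.
  by clear; eval_tables; lra.
have num_K0 : comb_re 0 ^+ 2 + comb_im 0 ^+ 2 <= (25 * 100) ^+ 2.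
  by rewrite /comb_re /comb_im; clear; eval_tables; lra.
have num_K1 : comb_re 1 ^+ 2 + comb_im 1 ^+ 2 <= (532 * 100 * 100) ^+ 2.
  by rewrite /comb_re /comb_im; clear; eval_tables; lra.
move=> hj le_g le_v.
have c_le : normc c <= 69 / 20.
  apply: (@le_trans _ _ (344 / 100)); last by clear; lra.
  by apply: normc_le_sqr => //; rewrite divr_ge0.
have v_le : normc v <= 69 / 20.
  apply: (@le_trans _ _ (344 / 100 + 1 / 200)); last by clear; lra.
  by apply: center_normc_le le_v => //; rewrite divr_ge0.
have nd := table_near dtab le_g v_le c_le le_v.
have nk := table_near ktab le_g v_le c_le le_v.
rewrite !cubic_center // in nd nk.
have {}nd := le_trans nd dtab_err_large.
have {}nk := le_trans nk ktab_err_large.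
have D0 := normc_ge_sqr hj num_D0 ltac:(by rewrite ?mulr_ge0).
have D1 := normc_le_sqr hj num_D1 ltac:(by rewrite ?mulr_ge0).
have K0 := normc_le_sqr hj num_K0 ltac:(by rewrite ?mulr_ge0).
have K1 := normc_le_sqr hj num_K1 ltac:(by rewrite ?mulr_ge0).
set X := table_eval dtab g v in nd *; set Y := table_eval ktab g v in nk *.
have n136 (x : R[i]) : normc (136 * x) = 136 * normc x.
  by rewrite normcM normc_nat.
have nL : normc (Y + 136 * X - (center (comb_re 0) (comb_im 0) j
    + g * center (comb_re 1) (comb_im 1) j)) <= 80 * 100 + 136 * 75.
  set A := center _ _ _ in nd; set B := center _ _ _ in nd.
  set A' := center _ _ _ in nk; set B' := center _ _ _ in nk.
  have -> : center (comb_re 0) (comb_im 0) j = A' + 136 * A.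
    by rewrite /A /A' /center /comb_re /comb_im; ring.
  have -> : center (comb_re 1) (comb_im 1) j = B' + 136 * B.
    by rewrite /B /B' /center /comb_re /comb_im; ring.
  have -> : Y + 136 * X - (A' + 136 * A + g * (B' + 136 * B)) =
    (Y - (A' + g * B')) + 136 * (X - (A + g * B)) by ring.
  by apply: le_trans (le_normcD _ _) _; rewrite n136 lerD // ler_wpM2l.
have leX := affine_normc_ge le_g D0 D1 nd.
have leL := affine_normc_le le_g K0 K1 nL.
have leY : normc Y <= normc (Y + 136 * X) + 136 * normc X.
  by rewrite -n136 -[normc (136 * X)]normcN -{1}(addrK (136 * X) Y) le_normcD.
split=> //; first by move: leX; clear; lra.
by move: leY leL; clear; lra.
Qed.

Lemma recentered_le v g (M gam : R) : normc v <= M -> normc g <= gam ->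
  normc (v + g * (v ^+ 2 - v)) <= M + gam * (M ^+ 2 + M).
Proof.
move=> le_v le_g; have v0 := normc_ge0 v.
apply: le_trans (le_normcD _ _) _; rewrite lerD // normcM ler_pM ?normc_ge0 //.
apply: le_trans (le_normcD _ _) _; rewrite normcN normcX lerD //.
by rewrite lerXn2r ?nnegrE // (le_trans v0).
Qed.

(** The hypotheses of [count_eq1] for [r = 204 |g|^2] and ten roots. Since [H(g, x0) = g^2 K], a
    factor [|g|^2] turns [1 / r] into [1 / 204] and is bounded by [(1 / 194)^2] next to [9 / rho].
    The bound [1 / 100 <= rho] ensures [r <= rho]. *)
Lemma root_bounds v g (x0 := v + g * (v ^+ 2 - v)) :
  v ^+ 4 = 8 * v ^+ 2 - 12 * v + 4 -> normc g <= 1 / 194 ->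
  exists rho M : R, [/\ 1 / 100 <= rho, normc x0 + rho <= M,
    rho * deriv2 hmaj M
      < normc (table_eval dtab g v)
    & normc (table_eval ktab g v) * (204^-1 + 9 / rho * (1 / 194) ^+ 2)
      < normc (table_eval dtab g v)].
Proof.
move=> hv le_g; have [j [hj near]] := quartic_root_near hv.
have [] : [/\ normc v <= 194 / 125, 117 <= normc (table_eval dtab g v)
      & normc (table_eval ktab g v) <= 20 * 100] \/
    [/\ normc v <= 69 / 20, 265 * 10 <= normc (table_eval dtab g v)
      & normc (table_eval ktab g v) <=
        136 * normc (table_eval dtab g v) + 490 * 100].
- case: near => near; [left|left|right]; last exact: large_bounds near.
    by apply: (small_bounds hj le_g near); clear; eval_tables; lra.
  by apply: (small_bounds hj le_g near); clear; eval_tables; lra.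
(* Uniqueness reads [1900 / 20 = 95 < 117]. *)
- case=> v_le D K; exists (1 / 20), (41 / 25).
  have x0_le := recentered_le v_le le_g; have h2 := hmaj_deriv2_small.
  split; first by clear; lra.
  + by move: x0_le; rewrite -/x0; clear; lra.
  + by move: D h2; clear; lra.
  + move: D K (normc_ge0 (table_eval ktab g v)); clear; lra.
(* Uniqueness reads [8100 / 4 = 2025 < 2650]; existence needs a [rho] larger than in the previous
   case. *)
- case=> v_le D K; exists (1 / 4), (19 / 5).
  have x0_le := recentered_le v_le le_g; have h2 := hmaj_deriv2_large.
  split; first by clear; lra.
  + by move: x0_le; rewrite -/x0; clear; lra.
  + by move: D h2; clear; lra.
  + move: D K (normc_ge0 (table_eval ktab g v)); clear; lra.
Qed.

End Bounds.

(** * Degree, affine substitution and the case [p = q] of [Qpoly] *)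

Section Qroots.
Variable C : fieldType.
Implicit Types (p q : C).

Lemma size_Qpoly_le p q : (size (Qpoly p q) <= 11)%N.
Proof.
apply/leq_sizeP => n /subnKC <-.
rewrite /Qpoly !(coefD, coefN, coefZ, coefXn, coefC) /=.
by rewrite !mulr0 !(addr0, subr0, oppr0).
Qed.

Lemma Qpoly_neq0 p q : Qpoly p q != 0.
Proof.
apply/eqP => /(congr1 (fun P : {poly C} => P`_10)) /eqP.
rewrite /Qpoly !(coefD, coefN, coefZ, coefXn, coefC, coef0) /=.
by rewrite !mulr0 !(addr0, subr0, oppr0) oner_eq0.
Qed.

Lemma prod_comp_affine (ws : seq C) (a b : C) : a != 0 ->
  (\prod_(w <- ws) ('X - w%:P)) \Po (a *: 'X + b%:P) =
  a ^+ size ws *: \prod_(w <- [seq (w - b) / a | w <- ws]) ('X - w%:P).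
Proof.
move=> a0; elim: ws => [|w ws IH] /=.
  by rewrite !big_nil comp_polyC scale1r.
rewrite !big_cons comp_polyM IH comp_polyB comp_polyX comp_polyC -scalerAr.
rewrite exprSr -scalerA [a *: (_ * _)]scalerAl; congr (_ *: (_ * _)).
by rewrite scalerBr scale_polyC mulrC divfK // polyCB opprB addrA.
Qed.

(** For [p = q] the polynomial is [(X^2 + q^4)^4 (X^2 - q^4)], and [X^2 + q^4] splits as
    [(X - j q^2) (X + j q^2)]. *)
Lemma mup_Qpoly_diag (j q : C) : j ^+ 2 = -1 ->
  (1 < mup (j * q ^+ 2) (Qpoly q q))%N.
Proof.
move=> hj; rewrite mup_geq ?Qpoly_neq0 //.
have -> : Qpoly q q = ('X - (j * q ^+ 2)%:P) ^+ 2
  * (('X - (j * q ^+ 2)%:P) ^+ 2 * ('X + (j * q ^+ 2)%:P) ^+ 4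
     * ('X^2 - (q ^+ 4)%:P)).
  have hjP : (j%:P : {poly C}) ^+ 2 = -1 by rewrite -polyC_exp hj polyCN.
  by rewrite /Qpoly -!mul_polyC; ring: hjP.
exact: dvdp_mulr.
Qed.

End Qroots.

(** * Transfer from the coordinate [x] back to the disks in [t] *)

Section DiskCount.
Variable R : realType.
Implicit Types (p q : int) (u v g : R[i]).

Lemma quartic_root u : root (quartic R) u ->
  (- 'i * u) ^+ 4 = 8 * (- 'i * u) ^+ 2 - 12 * (- 'i * u) + 4.
Proof.
have rot (C : comNzRingType) (j w : C) : j ^+ 2 = -1 ->
    w ^+ 4 + 8 * w ^+ 2 - 12 * j * w - 4 = 0 ->
    (- j * w) ^+ 4 = 8 * (- j * w) ^+ 2 - 12 * (- j * w) + 4.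
  move=> hj hw; rewrite -[RHS]addr0 -[X in _ = _ + X]hw.
  by ring: hj.
move=> /eqP hu; apply: rot; first exact: sqr_i.
move: hu; rewrite /quartic.
by rewrite !(hornerD, hornerN, hornerZ, hornerXn, hornerX, hornerC).
Qed.

Lemma nroots_Qpoly (g q v : R[i]) : g != 0 -> q != 0 -> normc g <= 1 / 194 ->
  v ^+ 4 = 8 * v ^+ 2 - 12 * v + 4 ->
  count (fun t => cball (v + g * (v ^+ 2 - v)) (204 * normc g ^+ 2)
                    ((t - 'i * q ^+ 2) / ('i * q ^+ 2 * (2 * g))))
    (roots_seq (Qpoly (q + 2 * g * q) q)) = 1%N.
Proof.
move=> g0 q0 le_g hv; set P := Qpoly _ _; set rs := roots_seq P.
have i0 : ('i : R[i]) != 0 by rewrite -normc_gt0 normc_i.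
have a0 : 'i * q ^+ 2 * (2 * g) != 0.
  by rewrite !mulf_neq0 ?expf_neq0 ?pnatr_eq0.
have eqP : P = lead_coef P *: \prod_(z <- rs) ('X - z%:P) := roots_seqE P.
have lc0 : lead_coef P != 0 by rewrite lead_coef_eq0 Qpoly_neq0.
have sz : (size rs <= 10)%N.
  have := size_Qpoly_le (q + 2 * g * q) q.
  by rewrite -/P eqP size_scale // size_prod_XsubC.
have k0 : 16 * g ^+ 4 * q ^+ 20 != 0.
  by rewrite !mulf_neq0 ?expf_neq0 ?pnatr_eq0.
have := Qpoly_htab g q; rewrite -/P eqP comp_polyZ prod_comp_affine // scalerA.
(* This exhibits [H(g, .)] as a constant times the product over the roots of [P] read in the
   coordinate [x]. *)
move=> /(congr1 ( *:%R (16 * g ^+ 4 * q ^+ 20)^-1)).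
rewrite !scalerA mulVf // scale1r => /esym eq_s.
have [rho [M [rho_ge x0_le uniq exis]]] := root_bounds hv le_g.
have ng0 : 0 < normc g by rewrite normc_gt0.
have ng2 : normc g ^+ 2 <= (1 / 194) ^+ 2.
  by rewrite lerXn2r ?nnegrE ?normc_ge0 ?divr_ge0.
rewrite -(htab_dtab _ hv) in uniq exis.
rewrite -(count_map (fun t => (t - 'i * q ^+ 2) / ('i * q ^+ 2 * (2 * g)))).
apply: (count_eq1 (n := 9) eq_s (htab_hmaj le_g)) x0_le uniq _.
- by rewrite size_map.
- by rewrite mulr_gt0 ?exprn_gt0.
- apply: le_trans rho_ge; move: ng2; clear; lra.
rewrite -/(table_eval htab g _) htab_ktab // normcM normcX.
apply: le_lt_trans exis.
have rho0 : 0 < rho by apply: lt_le_trans rho_ge; clear; lra.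
(* Used with [y = |g|^2], which cancels against the radius [204 |g|^2]. *)
have scale (y k : R) : y != 0 ->
    y * k * ((204 * y)^-1 + 9 / rho) = k * (204^-1 + 9 / rho * y).
  by move=> y0; field; rewrite y0 gt_eqF.
rewrite scale ?expf_neq0 ?gt_eqF // ler_wpM2l ?normc_ge0 // lerD2l.
by rewrite ler_wpM2l // divr_ge0 // ltW.
Qed.

(** The affine map from [x] to [t] sends [x0] exactly to the center of the disk. *)
Lemma disk_center (C : numFieldType) (j q g v w : C) : j ^+ 2 = -1 ->
  j * q ^+ 2 * (2 * g) * w + j * q ^+ 2 - j * q ^+ 2 - j * v * (2 * g * q) * q
    + (j * v + j * (j * v) ^+ 2) / 2 * (2 * g * q) ^+ 2
  = j * q ^+ 2 * (2 * g) * (w - (v + g * (v ^+ 2 - v))).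
Proof. by move=> hj; field: hj. Qed.

Lemma disk_cball p q u t (g := (p%:~R / (2 * q%:~R)) : R[i]) (v := - 'i * u) :
  0 < q -> p != 0 ->
  disk p q u t = cball (v + g * (v ^+ 2 - v)) (204 * normc g ^+ 2)
    ((t - 'i * q%:~R ^+ 2) / ('i * q%:~R ^+ 2 * (2 * g))).
Proof.
move=> q0 p0; have Q0 : (q%:~R : R) != 0 by rewrite intr_eq0 gt_eqF.
have qC : (q%:~R : R[i]) = (q%:~R : R)%:C by rewrite rmorph_int.
have Q0' : (q%:~R : R[i]) != 0 by rewrite intr_eq0 gt_eqF.
have P0 : (p%:~R : R[i]) != 0 by rewrite intr_eq0.
have i0 : ('i : R[i]) != 0 by rewrite -normc_gt0 normc_i.
have g0 : g != 0 by rewrite mulf_neq0 ?invr_eq0 ?mulf_neq0 ?pnatr_eq0.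
have eqp : p%:~R = 2 * g * q%:~R :> R[i] by rewrite /g; field; rewrite Q0'.
clearbody g.
have equ : u = 'i * v by rewrite /v mulrA mulrN -expr2 sqr_i opprK mul1r.
clearbody v.
have a0 : 'i * q%:~R ^+ 2 * (2 * g) != 0.
  by rewrite !mulf_neq0 ?expf_neq0 ?pnatr_eq0.
set w := (t - _) / _; rewrite /disk /cball.
have -> : t - 'i * q%:~R ^+ 2 - u * p%:~R * q%:~R
    + (u + 'i * u ^+ 2) / 2 * p%:~R ^+ 2 =
    'i * q%:~R ^+ 2 * (2 * g) * (w - (v + g * (v ^+ 2 - v))).
  have -> : t = 'i * q%:~R ^+ 2 * (2 * g) * w + 'i * q%:~R ^+ 2.
    by rewrite /w [X in X + _]mulrC divfK ?subrK.
  by rewrite equ eqp disk_center // sqr_i.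
have np : normc (p%:~R : R[i]) = 2 * normc g * q%:~R.
  rewrite eqp !normcM normc_nat normc_int.
  by rewrite [`|q|]gtr0_norm.
rewrite !normr_normc np normcM qC.
set x := 2 * normc g * q%:~R.
have -> : 51 * x%:C ^+ 3 / (q%:~R)%:C = (51 * x ^+ 3 / q%:~R)%:C :> R[i].
  rewrite [RHS]rmorphM /= fmorphV [X in _ = X / _]rmorphM /=.
  by rewrite rmorphXn rmorph_nat.
rewrite ltcR.
have na : normc ('i * (q%:~R : R)%:C ^+ 2 * (2 * g)) = 2 * normc g * q%:~R ^+ 2.
  rewrite !normcM normc_nat -qC normc_int [`|q|]gtr0_norm //.
  by rewrite normc_i mul1r mulrC expr2.
have a_gt0 : 0 < 2 * normc g * q%:~R ^+ 2 :> R.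
  by rewrite -na normc_gt0 -qC.
(* The radius [51 |p|^3 / q = 408 |g|^3 q^2] is the scale [2 |g| q^2] times [204 |g|^2]. *)
rewrite na -(ltr_pM2l a_gt0 (normc _)); congr (_ < _).
by rewrite /x; field.
Qed.

End DiskCount.

Theorem theorem5p1 (R : realType) (p q : int) (u : nat -> R[i])
    (hq : 0 < q) (hpq : 97 * `|p| <= q)
    (hu : quartic R = \prod_(2 <= k < 6) ('X - (u k)%:P)) :
  let P : {poly R[i]} := Qpoly (p + q)%:~R q%:~R in
  (p != 0 ->
    forall k : nat, (2 <= k <= 5)%N -> nroots_in P (disk p q (u k)) = 1%N)
  /\ (p = 0 -> (1 < mup ('i%C * q%:~R ^+ 2) P)%N).
Proof.
move=> P; split=> [p0 k hk|p0]; last first.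
  by rewrite /P p0 add0r mup_Qpoly_diag ?sqr_i.
have q0 : (q%:~R : R[i]) != 0 by rewrite intr_eq0 gt_eqF.
pose g : R[i] := p%:~R / (2 * q%:~R).
have g0 : g != 0 by rewrite mulf_neq0 ?intr_eq0 ?invr_eq0 ?mulf_neq0 ?pnatr_eq0.
have eqP : P = Qpoly (q%:~R + 2 * g * q%:~R) q%:~R.
  have pE : p%:~R = 2 * g * q%:~R by rewrite /g; field; rewrite q0.
  by rewrite /P rmorphD /= addrC [in LHS]pE.
have hv : (- 'i * u k) ^+ 4 = 8 * (- 'i * u k) ^+ 2 - 12 * (- 'i * u k) + 4.
  apply: quartic_root; rewrite hu -(big_map u predT (fun z => 'X - z%:P)).
  by rewrite root_prod_XsubC map_f // mem_index_iota ltnS.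
(* This is [97 |p| <= q] divided by [2 * 97 * q]. *)
have le_g : normc g <= 1 / 194.
  have q_gt0 : 0 < q%:~R :> R by rewrite ltr0z.
  rewrite /g normcM normcV normcM normc_nat !normc_int.
  rewrite [`|q|]gtr0_norm // ler_pdivrMr ?mulr_gt0 //.
  by move: hpq; rewrite -(ler_int R) rmorphM /=; clear; lra.
rewrite /nroots_in -(nroots_Qpoly g0 q0 le_g hv) -eqP.
by apply: eq_count => t; rewrite disk_cball.
Qed.
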